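(* For $A\subseteq[N]$ and $k\in\{0,\dots,|A|\}$, let $S_k(A)$ consist of the $k$ indices in $A$ with the largest contextual costs $\bar\kappa_i$, breaking ties by a fixed order, with $S_0(A)=\varnothing$. Then $T(S)\le T(S_k(A))$ for every $S\subseteq A$ with $|S|=k$. Define $$R(A)=\max\{k\in\{0,\dots,|A|\}\mid T(S_k(A))\ge\theta\}.$$ Every feasible solution to the mixed-integer program (MIP) of the context satisfies $$\sum_{i\in A}\mathfrak z_i\le R(A).$$ The bound is sharp for the binary transportation projection in which $\vartheta(d)\ge\theta$, $d_i=0$ whenever $\mathfrak z_i=1$, and the other distances are unrestricted finite nonnegative values; that is, $R(A)$ is the maximum of $\sum_{i\in A}\mathfrak z_i$ over all $\mathfrak z\in\{0,1\}^N$ for which there exists $d\in\mathbb R_+^N$ with $\vartheta(d)\ge\theta$ and $d_i=0$ whenever $\mathfrak z_i=1$.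
   Context: $[N]=\{1,\dots,N\}$, $[a]_+=\max\{a,0\}$, $\mathbf 1$ all-ones. Two distinct symbols: $\varepsilon\in(0,1]$ (lower bound on the conditioning probability) and $\epsilon\in(0,1)$ (risk limit). $\mathcal X$ is the context space with metric $d_{\mathcal X}$; the outcome space is $\mathcal Y=\mathbb R^{\dim(y)}$ with $d_{\mathcal Y}$ induced by a norm $\|\cdot\|_{\mathcal Y}$ with dual norm $\|\cdot\|_{\mathcal Y,*}$. Samples $(\hat x_i,\hat y_i)$, $i\in[N]$, $\widehat{\mathbb P}_N=\frac1N\sum_i\delta_{(\hat x_i,\hat y_i)}$. $W$ is the type-1 Wasserstein distance with ground metric $d_{\mathcal X}+d_{\mathcal Y}$. $\mathcal N=\mathcal N_\gamma(x_0)\subseteq\mathcal X$ contains $x_0$ and lies within $d_{\mathcal X}$-distance $\gamma\ge0$ of $x_0$. Safety sets: $\mathcal S(z)=\{y:y^\top b_p+d_p-z^\top a_p>0\ \forall p\in[P]\}$ with $b_p\ne0$; $\mathcal S^c(z)=\mathcal Y\setminus\mathcal S(z)$. $\mathcal Z$ is a nonempty bounded mixed-integer polyhedron and $c$ is linear. Standing assumptions: $\mathcal X,\mathcal Y$ Polish with Borel $\sigma$-fields, transport allowed on all of $\mathcal X\times\mathcal Y$; $\mathcal N$ Borel with finite distances from each $\hat x_i$ to $\mathcal N$ and $\mathcal N^c$; for each $z\in\mathcal Z$, $\mathcal S^c(z)$ is a nonempty Borel set at finite distance from each $\hat y_i$; and $\theta>\theta_{\min}:=\inf\{W(\mathbb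 P,\widehat{\mathbb P}_N):\mathbb P_X(\mathcal N)\ge\varepsilon\}$, where $\mathbb P_X$ is the $\mathcal X$-marginal. Constants: $\kappa_i^{\rm in}=\inf_{x\in\mathcal N}d_{\mathcal X}(\hat x_i,x)$, $\kappa_i^{\rm out}=\inf_{x\in\mathcal N^c}d_{\mathcal X}(\hat x_i,x)$, $\bar\kappa_i=\kappa_i^{\rm in}-\kappa_i^{\rm out}$, $K_0=\frac1N\sum_i\kappa_i^{\rm out}$. Margins: $m_{ip}(z)=(\hat y_i^\top b_p+d_p-z^\top a_p)/\|b_p\|_{\mathcal Y,*}$. Finite constants: $M_{ip}\ge\max_{z\in\mathcal Z}[-m_{ip}(z)]_+$, $\overline\Delta_i\ge\max_{z\in\mathcal Z}[\min_pm_{ip}(z)]_+$. (MIP): minimize $c(z)$ over $(z,\delta,\mathfrak z,t,\lambda,s,v)$ subject to $K_0+\epsilon\varepsilon t-\varepsilon\lambda-\frac1N\sum_iv_i\ge\theta$; and for all $i\in[N]$: $v_i+\lambda\ge s_i$, $\delta_i+\bar\kappa_i\ge t-s_i$, $0\le\delta_i\le\overline\Delta_i(1-\mathfrak z_i)$, $\delta_i\le m_{ip}(z)+M_{ip}\mathfrak z_i$ for all $p\in[P]$, $s_i\ge-\bar\kappa_i$, $v_i\ge0$; $\lambda\le\epsilon t$, $t\ge0$, $\lambda\in\mathbb R$, $s\in\mathbb R^N$, $z\in\mathcal Z$, $\mathfrak z\in\{0,1\}^N$. Let $\mathcal C_{\varepsilon,\epsilon}=\{(w,r)\in\mathbb R^{2N}:0\le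 r\le w\le\frac1N\mathbf 1,\ \mathbf 1^\top w\ge\varepsilon,\ \mathbf 1^\top r=\epsilon\mathbf 1^\top w\}$ and $\vartheta(d)=\min_{(w,r)\in\mathcal C_{\varepsilon,\epsilon}}\{K_0+\bar\kappa^\top w+d^\top r\}$ for $d\in\mathbb R_+^N$. For $S\subseteq[N]$, $$T(S)=\min\{K_0+\bar\kappa^\top w: (w,r)\in\mathcal C_{\varepsilon,\epsilon},\ r_i=0\ \forall i\notin S\},$$ with value $+\infty$ if infeasible. *)

(* Defs.v *)
(* MathComp-Analysis, over an arbitrary [R : realType]. *)
From HB Require Import structures.
From mathcomp Require Import all_boot all_order all_algebra.
From mathcomp Require Import all_classical all_reals all_analysis.

Set Implicit Arguments.
Unset Strict Implicit.
Unset Printing Implicit Defensive.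

Import Order.TTheory GRing.Theory Num.Theory.
Import numFieldTopology.Exports numFieldNormedType.Exports.

Local Open Scope classical_set_scope.
Local Open Scope ring_scope.

(* The point is only there because measurable types are pointed in the
   library; a metric space with a distinguished context is never empty. *)
#[short(type="pMetricType")]
HB.structure Definition PointedMetric (K : numDomainType) :=
  { M of Metric K M & Pointed M }.

Section Generic.
Context {R : realType}.

(* The complete metric need not be the given one: only the topology matters. *)
Definition polish (T : topologicalType) : Prop :=
  (exists2 D : set T, countable D & dense D) /\
  exists d : T -> T -> R,
    [/\ forall x y, d x y = 0 <-> x = y,
        forall x y, d x y = d y x,
        forall x y z, d x z <= d x y + d y z,
        forall (x : T) (U : set T),
          nbhs x U <-> exists2 e, 0 < e & [set y | d x y < e] `<=` U
      & forall u : nat -> T,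
          (forall e, 0 < e -> exists k0, forall k l,
             (k0 <= k)%N -> (k0 <= l)%N -> d (u k) (u l) < e) ->
          exists x : T, u @ \oo --> x].

Definition dot k (u v : 'rV[R]_k) : R := \sum_i u 0 i * v 0 i.

Record is_norm k (nu : 'rV[R]_k -> R) : Prop := IsNorm {
  is_norm_triangle : forall u v, nu (u + v) <= nu u + nu v;
  is_norm_scale : forall (a : R) u, nu (a *: u) = `|a| * nu u;
  is_norm_eq0 : forall u, nu u = 0 -> u = 0 }.

Definition dual_norm k (nu : 'rV[R]_k -> R) (b : 'rV[R]_k) : R :=
  sup [set dot y b | y in [set y | nu y <= 1]].

Definition pos_part (a : R) : R := Num.max a 0.

(* +oo when E is empty. *)
Definition dist_to T (d : T -> T -> R) (x : T) (E : set T) : \bar R :=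
  ereal_inf [set (d x y)%:E | y in E].

Definition coupling disp (T : measurableType disp) (mu nu : set T -> \bar R)
    (pi : probability (T * T)%type R) : Prop :=
  forall E, measurable E ->
    pushforward pi fst E = mu E /\ pushforward pi snd E = nu E.

Definition wasserstein1 disp (T : measurableType disp) (d : T -> T -> R)
    (mu nu : set T -> \bar R) : \bar R :=
  ereal_inf [set (\int[pi]_p (d p.1 p.2)%:E)%E |
             pi in [set pi : probability (T * T)%type R | coupling mu nu pi]].

Definition empirical disp (T : measurableType disp) N (xi : 'I_N -> T)
    (E : set T) : \bar R :=
  ((N%:R^-1)%:E * \sum_(i < N) \d_(xi i) E)%E.

End Generic.

Arguments polish R T : clear implicits.

Definition borel (T : ptopologicalType) := g_sigma_algebraType (@open T).

Record instance (R : realType) (X : pMetricType R) (n q P N : nat) :=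
  Instance {
  xhat : 'I_N -> X;
  yhat : 'I_N -> 'rV[R]_n;
  normY : 'rV[R]_n -> R;
  x0 : X;
  gamma : R;
  nbhd : set X;
  (* outcome safety constraints  y.b_p + d_p - z.a_p > 0 *)
  safe_b : 'I_P -> 'rV[R]_n;
  safe_d : 'I_P -> R;
  safe_a : 'I_P -> 'rV[R]_q;
  (* the mixed-integer polyhedron  { z | G z <= h, z_j integer for j in J } *)
  nrows : nat;
  poly_G : 'M[R]_(nrows, q);
  poly_h : 'rV[R]_nrows;
  poly_J : {set 'I_q};
  (* the objective; it plays no role in feasibility *)
  cost : {linear 'rV[R]_q -> R^o};
  (* lower bound on the probability of the conditioning event *)
  cond_eps : R;
  (* risk limit *)
  risk_eps : R;
  theta : R;
  bigM : 'I_N -> 'I_P -> R;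
  Delta : 'I_N -> R }.

Section Problem.
Context {R : realType} {X : pMetricType R} {n q P N : nat}.
Variable I : instance X n q P N.

Notation sample_space := (borel X * borel 'rV[R]_n)%type.

Definition distY (y y' : 'rV[R]_n) : R := normY I (y - y').

Definition ground (u v : sample_space) : R :=
  @mdist R X u.1 v.1 + distY u.2 v.2.

Definition empirical_dist : set sample_space -> \bar R :=
  empirical (fun i => (xhat I i, yhat I i) : sample_space).

Definition theta_min : \bar R :=
  ereal_inf [set wasserstein1 ground Pr empirical_dist |
    Pr in [set Pr : probability sample_space R |
             ((cond_eps I)%:E <= pushforward Pr fst (nbhd I))%E]].

Definition zset : set 'rV[R]_q :=
  [set z | (forall k, (z *m (poly_G I)^T) 0 k <= poly_h I 0 k) /\
           (forall j, j \in poly_J I -> z 0 j \is a Num.int)].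

Definition safe (z : 'rV[R]_q) : set 'rV[R]_n :=
  [set y | forall p,
     0 < dot y (safe_b I p) + safe_d I p - dot z (safe_a I p)].

Definition margin (i : 'I_N) (p : 'I_P) (z : 'rV[R]_q) : R :=
  (dot (yhat I i) (safe_b I p) + safe_d I p - dot z (safe_a I p))
    / dual_norm (normY I) (safe_b I p).

Definition kappa_in (i : 'I_N) : \bar R :=
  dist_to (@mdist R X) (xhat I i) (nbhd I).

Definition kappa_out (i : 'I_N) : \bar R :=
  dist_to (@mdist R X) (xhat I i) (~` nbhd I).

Definition kbar (i : 'I_N) : R := fine (kappa_in i) - fine (kappa_out i).

Definition K0 : R := N%:R^-1 * \sum_i fine (kappa_out i).

Record standing : Prop := Standing {
  N_gt0 : (0 < N)%N;
  cond_eps_bounds : 0 < cond_eps I <= 1;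
  risk_eps_bounds : 0 < risk_eps I < 1;
  X_polish : polish R X;
  normY_norm : is_norm (normY I);
  gamma_ge0 : 0 <= gamma I;
  x0_nbhd : nbhd I (x0 I);
  nbhd_near : forall x, nbhd I x -> mdist (x0 I) x <= gamma I;
  nbhd_borel : measurable (nbhd I : set (borel X));
  kappa_in_fin : forall i, kappa_in i \is a fin_num;
  kappa_out_fin : forall i, kappa_out i \is a fin_num;
  safe_b_neq0 : forall p, safe_b I p != 0;
  zset_nonempty : zset !=set0;
  zset_bounded : bounded_set zset;
  unsafe_nonempty : forall z, zset z -> ~` safe z !=set0;
  unsafe_borel : forall z, zset z ->
    measurable (~` safe z : set (borel 'rV[R]_n));
  unsafe_dist_fin : forall z, zset z -> forall i,
    dist_to distY (yhat I i) (~` safe z) \is a fin_num;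
  theta_gt : (theta_min < (theta I)%:E)%E;
  bigM_ge : forall i p z, zset z -> pos_part (- margin i p z) <= bigM I i p;
  Delta_ge : forall i z, zset z ->
    (maxe (\big[mine/+oo]_(p < P) (margin i p z)%:E) 0 <= (Delta I i)%:E)%E }.

Record mip_feasible (z : 'rV[R]_q) (delta : 'rV[R]_N) (fz : {ffun 'I_N -> bool})
    (t lambda : R) (s v : 'rV[R]_N) : Prop := MipFeasible {
  mip_budget :
    theta I <= K0 + risk_eps I * cond_eps I * t - cond_eps I * lambda
               - N%:R^-1 * \sum_i v 0 i;
  mip_v : forall i, s 0 i <= v 0 i + lambda;
  mip_s : forall i, t - s 0 i <= delta 0 i + kbar i;
  mip_delta_ge0 : forall i, 0 <= delta 0 i;
  mip_delta_Delta : forall i, delta 0 i <= Delta I i * (1 - (fz i)%:R);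
  mip_delta_margin : forall i p,
    delta 0 i <= margin i p z + bigM I i p * (fz i)%:R;
  mip_s_ge : forall i, - kbar i <= s 0 i;
  mip_v_ge0 : forall i, 0 <= v 0 i;
  mip_lambda : lambda <= risk_eps I * t;
  mip_t_ge0 : 0 <= t;
  mip_z : zset z }.

Definition Cset : set ('rV[R]_N * 'rV[R]_N) :=
  [set wr : 'rV[R]_N * 'rV[R]_N |
            [/\ forall i, 0 <= wr.2 0 i <= wr.1 0 i,
                forall i, wr.1 0 i <= N%:R^-1,
                cond_eps I <= \sum_i wr.1 0 i
              & \sum_i wr.2 0 i = risk_eps I * \sum_i wr.1 0 i]].

Definition kcost (w : 'rV[R]_N) : R := K0 + \sum_i kbar i * w 0 i.

(* The minima below are infima of linear functions over compact sets; the
   infimum of the empty set is +oo. *)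
Definition vartheta (d : 'rV[R]_N) : \bar R :=
  ereal_inf [set (kcost wr.1 + dot d wr.2)%:E | wr in Cset].

Definition Tval (S : {set 'I_N}) : \bar R :=
  ereal_inf [set (kcost wr.1)%:E |
    wr in [set wr | Cset wr /\ forall i, i \notin S -> wr.2 0 i = 0]].

(* Decreasing contextual cost, ties broken by [tie]. *)
Definition before (tie : rel 'I_N) : rel 'I_N :=
  fun i j => (kbar j < kbar i) || ((kbar i == kbar j) && tie i j).

Definition topk (tie : rel 'I_N) (A : {set 'I_N}) (k : nat) : {set 'I_N} :=
  [set i | i \in take k (sort (before tie) (enum A))]%SET.

(* The index k = 0 always qualifies, see [Tval_set0]. *)
Definition Rbound (tie : rel 'I_N) (A : {set 'I_N}) : nat :=
  \max_(k < #|A|.+1 | ((theta I)%:E <= Tval (topk tie A k))%E) k.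

Definition projection_feasible (fz : {ffun 'I_N -> bool}) : Prop :=
  exists d : 'rV[R]_N,
    [/\ forall i, 0 <= d 0 i,
        ((theta I)%:E <= vartheta d)%E
      & forall i, fz i -> d 0 i = 0].

Lemma Tval_set0 : standing -> Tval finset.set0 = +oo%E.
Proof.
move=> st; rewrite /Tval (_ : [set wr | _] = set0) ?image_set0 ?ereal_inf0//.
rewrite -subset0 => -[w r] /= [[_ _ hw hr] r0].
have r_eq0 : \sum_i r 0 i = 0 by apply: big1 => i _; apply: r0; rewrite inE.
have /andP[e0 _] := cond_eps_bounds st; have /andP[a0 _] := risk_eps_bounds st.
by move: (mulr_gt0 a0 (lt_le_trans e0 hw)); rewrite -hr r_eq0 ltxx.
Qed.

End Problem.

(* Main.v *)
Require Import Defs.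
From mathcomp Require Import all_boot all_order all_algebra.
From mathcomp Require Import all_classical all_reals all_analysis.
From mathcomp Require Import perm ring lra.

(** Call a pair [(w, r)] in [Cset] a plan, and [r] its risky mass.  Three facts
    carry the theorem.

    Exchange ([Tval_exchange], [Tval_le_topk]).  Replacing in S an index by one
    of larger contextual cost can only raise T(S): a plan whose risky mass [r]
    avoids the cheap index is turned into one avoiding the costly index by
    swapping the two coordinates of [r], and those of [w] exactly when this
    moves mass to the cheaper index.  Repeating the exchange turns any subset
    of A into the set of the costliest indices of the same size.

    Weak duality ([mip_projection]).  The variables [t], [lambda], [s], [v] are
    a dual certificate that vartheta(delta) >= theta, and the rows with [Delta] force
    delta to vanish on the ones of the binary vector.  So a solution of the
    mixed-integer program is feasible for the binary projection, and a
    projection-feasible vector with set of ones S in A has T(S) >= theta,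
    because the distances do not charge a plan with [r] supported in S.  With
    the exchange this bounds the number of ones by the largest k for which the
    k costliest indices qualify.

    Exact penalty ([exact_penalty]).  Conversely, if T(S) >= theta, then a
    finite distance M off S, and zero on S, suffices for vartheta(d) >= theta.
    Let eta be the risky mass outside S.  If S has room for the mass that the
    risk constraint demands, every plan is within O(eta) of a plan supported in
    S ([Cset_repair]), so a large M pays for the difference in contextual cost.
    Compactness alone would only give that the penalised minimum tends to T(S)
    as M grows, which is not enough when T(S) = theta.  If S has too
    little room, then eta is bounded below and M beats the bounded contextual
    cost.  Applied to the costliest indices, this shows that the bound is
    attained. *)

Section Proof.
Set Implicit Arguments.
Unset Strict Implicit.
Import Order.TTheory GRing.Theory Num.Theory.
Local Open Scope ring_scope.

Context {R : realType} {X : pMetricType R} {n q P N : nat}.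
Context (I : instance X n q P N) (hI : standing I).
Implicit Types (S A : {set 'I_N}) (w r d : 'rV[R]_N) (x : \bar R).

(** * Exchanging one index *)

Lemma Tval_le S w r : Cset I (w, r) -> (forall i, i \notin S -> r 0 i = 0) ->
  (Tval I S <= (kcost I w)%:E)%E.
Proof. by move=> hC hS; apply: ereal_inf_lbound; exists (w, r). Qed.

Lemma Tval_ge S x :
  (forall w r, Cset I (w, r) -> (forall i, i \notin S -> r 0 i = 0) ->
     (x <= (kcost I w)%:E)%E) -> (x <= Tval I S)%E.
Proof. by move=> h; apply/ereal_infP => _ [[w r] [hC hS] <-]; apply: (h w r). Qed.

(** From a plan avoiding [i] one builds a plan avoiding [j]: the coordinates
    [i] and [j] of [r] are always swapped.  If [w i <= w j], those of [w] are
    swapped too, which moves mass from the costlier [j] to [i]; otherwise [w]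
    already leaves room at [i] for the mass [r j], since [r j <= w j < w i]. *)
Lemma Tval_exchange S i j : i \notin S -> j \notin S ->
  kbar I i <= kbar I j -> (Tval I (i |: S) <= Tval I (j |: S))%E.
Proof.
move=> iS jS kij; have [->//|neq_ij] := eqVneq i j.
apply: Tval_ge => w r [/= hr hw hcond hrisk] r0.
have ri0 : r 0 i = 0 by apply: r0; rewrite !inE negb_or neq_ij.
pose swap (u : 'rV[R]_N) : 'rV[R]_N := \row_l u 0 (tperm i j l).
have sum_swap u : \sum_l swap u 0 l = \sum_l u 0 l.
  rewrite [RHS](reindex_inj (@perm_inj _ (tperm i j))) /=.
  by apply: eq_bigr => l _; rewrite mxE.
have swap0 l : l \notin i |: S -> swap r 0 l = 0.
  rewrite !inE negb_or mxE => /andP[li lS].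
  by case: tpermP => [e|e|_ lj]; rewrite ?e ?eqxx in li *;
    [| |apply: r0; rewrite !inE negb_or lS andbT; apply/eqP].
have [wij|wji] := leP (w 0 i) (w 0 j).
  apply: le_trans (_ : (kcost I (swap w))%:E <= _)%E.
    apply: (@Tval_le _ _ (swap r)) => //; split => /=.
    - by move=> l; rewrite !mxE.
    - by move=> l; rewrite mxE.
    - by rewrite sum_swap.
    - by rewrite !sum_swap.
  rewrite lee_fin /kcost lerD2l.
  rewrite (bigD1 i)//= (bigD1 j) 1?eq_sym//= [leRHS](bigD1 i)//=.
  rewrite [X in _ <= _ + X](bigD1 j) 1?eq_sym//= !mxE tpermL tpermR.
  rewrite (eq_bigr (fun l => kbar I l * w 0 l)).
    set s := \sum_(_ | _) _.
    have : 0 <= (kbar I j - kbar I i) * (w 0 j - w 0 i).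
      by rewrite mulr_ge0 ?subr_ge0.
    by nra.
  by move=> l /andP[li lj]; rewrite mxE tpermD// eq_sym.
apply: (@Tval_le _ _ (swap r)) => //; split => //=; last by rewrite sum_swap.
move=> l; rewrite mxE; case: tpermP => [->|->|_ _]; last exact: hr.
  by have /andP[-> hj] := hr j; rewrite (le_trans hj)// ltW.
by rewrite ri0 lexx; have /andP[h1 h2] := hr j; exact: le_trans h1 h2.
Qed.

(** * The costliest indices of a set *)

Section TopCosts.
Variables (tie : rel 'I_N) (tie_total : total tie) (A : {set 'I_N}).
Local Notation topk := (topk I tie A).

Lemma card_topk k : (k <= #|A|)%N -> #|topk k| = k.
Proof.
move=> kA; have us : uniq (take k (sort (before I tie) (enum A))).
  by rewrite take_uniq// sort_uniq enum_uniq.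
rewrite /Defs.topk cardsE (card_uniqP us) size_takel// size_sort.
by rewrite -cardE.
Qed.

Lemma topk_sub k : topk k \subset A.
Proof.
by apply/fintype.subsetP => i; rewrite inE => /mem_take; rewrite mem_sort mem_enum.
Qed.

Lemma kbar_topk k i j : i \in A -> i \notin topk k -> j \in topk k ->
  kbar I i <= kbar I j.
Proof.
move=> iA; rewrite !inE => iS jS.
have srt : sorted (fun a b => kbar I b <= kbar I a)
    (sort (before I tie) (enum A)).
  apply: sub_sorted (sort_sorted _ _).
    by move=> a b /orP[/ltW//|/andP[/eqP-> _]].
  move=> a b; rewrite /before; have [_|_|e] := ltgtP (kbar I a) (kbar I b) => //.
  exact: tie_total.
rewrite sorted_pairwise in srt; last by move=> a b c /[swap]; exact: le_trans.
move: srt; rewrite -[s in pairwise _ s](cat_take_drop k) pairwise_cat.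
case/andP => /allrelP + _; apply => //.
have : i \in sort (before I tie) (enum A) by rewrite mem_sort mem_enum.
by rewrite -{1}[sort _ _](cat_take_drop k) mem_cat (negbTE iS).
Qed.

(** Each exchange brings [S] one index closer to the costliest ones: an index
    of [S] outside [topk k] costs at most as much as any index of [topk k], so
    it can be traded for one that [S] misses.  The induction is on the number
    of missed indices. *)
Lemma Tval_le_topk k S : (k <= #|A|)%N -> S \subset A -> #|S| = k ->
  (Tval I S <= Tval I (topk k))%E.
Proof.
move=> kA; have [m] := ubnP #|topk k :\: S|.
elim: m S => // m IHm S lt_m SA cS.
have [TS|] := boolP (topk k \subset S).
  by have /eqP -> : topk k == S by rewrite eqEcard TS card_topk// cS leqnn.
case/fintype.subsetPn => j jT jS.
have /fintype.subsetPn[i iS iT] : ~~ (S \subset topk k).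
  apply: contra jS => ST.
  by have /eqP -> : S == topk k by rewrite eqEcard ST card_topk// cS leqnn.
have iA := fintype.subsetP SA _ iS.
have jSi : j \notin S :\ i by rewrite inE (negbTE jS) andbF.
rewrite -(finset.setD1K iS); apply: le_trans (_ : Tval I (j |: S :\ i) <= _)%E.
  by apply: Tval_exchange (kbar_topk iA iT jT); rewrite // !inE eqxx.
apply: IHm.
- have sub : topk k :\: (j |: S :\ i) \subset (topk k :\: S) :\ j.
    apply/fintype.subsetP => l; rewrite !inE !negb_or negb_and negbK.
    case/andP => /andP[-> /orP[/eqP->|->->//]].
    by move=> h; move: iT; rewrite inE h.
  have jD : j \in topk k :\: S by rewrite inE jS.
  rewrite (cardsD1 j) jD in lt_m.
  exact: leq_ltn_trans (subset_leq_card sub) lt_m.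
- apply/fintype.subsetP => l; rewrite !inE => /orP[/eqP->|/andP[_]].
    exact: (fintype.subsetP (topk_sub k)).
  exact: (fintype.subsetP SA).
- by rewrite cardsU1 jSi -cS (cardsD1 i S) iS.
Qed.

Lemma Rbound_ge k : (k <= #|A|)%N -> ((theta I)%:E <= Tval I (topk k))%E ->
  (k <= Rbound I tie A)%N.
Proof.
by move=> kA h; rewrite -ltnS in kA; apply: (leq_bigmax_cond (Ordinal kA)).
Qed.

(** The maximum is over a nonempty range, as [k = 0] gives the empty set, whose
    value is infinite; hence it is attained. *)
Lemma Tval_topk_Rbound : ((theta I)%:E <= Tval I (topk (Rbound I tie A)))%E
  /\ (Rbound I tie A <= #|A|)%N.
Proof.
rewrite /Rbound.
have h0 : ((theta I)%:E <= Tval I (topk (@ord0 #|A|)))%E.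
  have -> : topk (@ord0 #|A|) = finset.set0.
    by apply/setP => i; rewrite !inE /= take0.
  by rewrite Tval_set0// leey.
rewrite (bigop.bigmax_eq_arg (ord0 : 'I_(#|A|.+1))) //.
case: arg_maxnP => // k hk _; split => //.
by rewrite -ltnS.
Qed.

End TopCosts.

(** * From the mixed-integer program to the projection *)

(** Weak linear programming duality, index by index: each constraint of the
    program is multiplied by the nonnegative quantity it pairs with in a plan,
    namely [r i], [w i - r i], [w i] or the slack of the capacity [1 / N].
    Summing, the total mass enters with coefficient
    [risk_eps I * t - lambda >= 0] and is at least [cond_eps I]. *)
Lemma mip_projection z (delta s v : 'rV[R]_N) fz t lambda :
  mip_feasible I z delta fz t lambda s v -> projection_feasible I fz.
Proof.
move=> [hb hv hs hd0 hdD _ hsk hv0 hl ht0 _]; exists delta; split=> //; last first.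
  move=> i fi; apply/eqP; rewrite eq_le hd0 andbT.
  by apply: le_trans (hdD i) _; rewrite fi subrr mulr0.
apply/ereal_infP => _ [[w r] [/= hr hw hcond hrisk] <-].
rewrite lee_fin /kcost /dot; apply: le_trans hb _.
have term i : t * r 0 i - lambda * w 0 i - N%:R^-1 * v 0 i
    <= kbar I i * w 0 i + delta 0 i * r 0 i.
  have /andP[r0 rw] := hr i; have w0 := le_trans r0 rw.
  have h1 : 0 <= r 0 i * (delta 0 i + kbar I i - (t - s 0 i)).
    by rewrite mulr_ge0// subr_ge0.
  have h2 : 0 <= (w 0 i - r 0 i) * (kbar I i + s 0 i).
    by rewrite mulr_ge0 ?subr_ge0// addrC -lerBlDr sub0r.
  have h3 : 0 <= w 0 i * (v 0 i + lambda - s 0 i).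
    by rewrite mulr_ge0// subr_ge0.
  have h4 : 0 <= (N%:R^-1 - w 0 i) * v 0 i by rewrite mulr_ge0 ?subr_ge0.
  by nra.
have := ler_sum (index_enum 'I_N) (P := xpredT) (fun i _ => term i).
rewrite !sumrB big_split /= -!mulr_sumr hrisk.
have : 0 <= (risk_eps I * t - lambda) * (\sum_i w 0 i - cond_eps I).
  by rewrite mulr_ge0 ?subr_ge0.
by nra.
Qed.

(** Distances that vanish on [S] leave plans with risky mass in [S] uncharged,
    so on those plans [vartheta] bounds the contextual cost alone. *)
Lemma projection_Tval fz S : projection_feasible I fz ->
  (forall i, i \in S -> fz i) -> ((theta I)%:E <= Tval I S)%E.
Proof.
move=> [d [d0 hd dfz]] hS; apply: Tval_ge => w r hC r0.
apply: le_trans hd _; apply: ereal_inf_lbound; exists (w, r) => //=.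
rewrite /dot big1 ?addr0// => i _.
have [/hS/dfz->|/r0->] := boolP (i \in S); by rewrite ?mul0r ?mulr0.
Qed.

Lemma projection_le_Rbound tie A fz : total tie -> projection_feasible I fz ->
  (\sum_(i in A) fz i <= Rbound I tie A)%N.
Proof.
move=> tie_total hp; pose S := [set i in A | fz i].
have -> : (\sum_(i in A) fz i = #|S|)%N.
  rewrite -sum1_card [RHS](eq_bigl (fun i => (i \in A) && fz i)).
    by rewrite [RHS]big_mkcondr; apply: eq_bigr => i _; case: (fz i).
  by move=> i; rewrite inE.
have SA : S \subset A by apply/fintype.subsetP => i; rewrite inE => /andP[].
have cS := subset_leq_card SA.
apply: Rbound_ge => //; apply: le_trans (@Tval_le_topk tie tie_total A _ S cS SA erefl).
by apply: projection_Tval hp _ => i; rewrite inE => /andP[].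
Qed.

(** * Exact penalisation of the mass outside a set *)

(** An error bound for the face of the polytope on which [r] is supported in
    [S]: a plan is as close to it as its risky mass [eta] outside [S], up to the
    factor [1 / risk_eps I].  Only [w] needs care, since [r] can be spread over
    [S] in proportion to [w] once [S] holds the fraction [risk_eps I] of the
    total mass.  In the given plan that fraction is short by at most [eta].  So
    every coordinate in [S] is raised by [eta], up to the capacity, and the mass
    off [S] is scaled down if it is still too large.  The scaling
    costs at most [eta / risk_eps I], and it cannot spoil the lower bound on
    the total mass: when it is active the total is the mass of [S] divided by
    [risk_eps I], and the mass of [S] is at least [risk_eps I * cond_eps I],
    either because the raise has covered the defect or because [S] is full. *)
Lemma Cset_repair S w r :
  risk_eps I * cond_eps I <= #|S|%:R * N%:R^-1 -> Cset I (w, r) ->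
  exists w' r' : 'rV[R]_N, [/\ Cset I (w', r'),
    forall i, i \notin S -> r' 0 i = 0 &
    forall i, `|w' 0 i - w 0 i| <= (\sum_(j | j \notin S) r 0 j) / risk_eps I].
Proof.
move=> cap [/= hr hw hcond hrisk].
have /andP[cond0 _] := cond_eps_bounds hI.
have /andP[risk0 risk1] := risk_eps_bounds hI.
have w_ge0 i : 0 <= w 0 i by have /andP[] := hr i; exact: le_trans.
have r_ge0 i : 0 <= r 0 i by have /andP[] := hr i.
set eta := \sum_(j | _) _.
have eta0 : 0 <= eta by apply: sumr_ge0.
have splitS (F : 'I_N -> R) :
    \sum_i F i = \sum_(i in S) F i + \sum_(i | i \notin S) F i.
  by rewrite (bigID (mem S)).
pose a0 := \sum_(i in S) w 0 i; pose b0 := \sum_(i | i \notin S) w 0 i.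
have b0_ge0 : 0 <= b0 by apply: sumr_ge0.
have defect : risk_eps I * (a0 + b0) - eta <= a0.
  have : \sum_(i in S) r 0 i <= a0.
    by apply: ler_sum => i _; have /andP[] := hr i.
  by move: hrisk; rewrite !splitS -/a0 -/b0 -/eta => <-; rewrite addrK.
rewrite splitS -/a0 -/b0 in hcond.
(* [up] is the new mass in [S], of total [a]; [b] below is the new total off
   [S], the largest one at most [b0] for which [S] holds its fraction. *)
pose up i : R := Num.min (w 0 i + eta) N%:R^-1.
have w_up i : w 0 i <= up i by rewrite le_min hw lerDl eta0.
pose a := \sum_(i in S) up i.
have a0_a : a0 <= a by apply: ler_sum.
have a_ge : risk_eps I * cond_eps I <= a.
  (* Either one coordinate receives the whole [eta], which already covers the
     defect, or all coordinates in [S] are filled to capacity. *)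
  have [/existsP[i /andP[iS hi]]|/existsPn hS] :=
      boolP [exists i, (i \in S) && (w 0 i + eta <= N%:R^-1)].
    have : a0 + eta <= a.
      rewrite /a0 /a (bigD1 i)//= [leRHS](bigD1 i)//= {1}/up min_l//.
      have : \sum_(j in S | j != i) w 0 j <= \sum_(j in S | j != i) up j.
        by apply: ler_sum.
      by lra.
    by nra.
  apply: le_trans cap _; rewrite mulr_natl -sumr_const; apply: ler_sum => i iS.
  by move: (hS i); rewrite iS /= -ltNge => hi; rewrite /up min_r// ltW.
have a_gt0 : 0 < a by apply: lt_le_trans a_ge; exact: mulr_gt0.
pose b := Num.min b0 ((1 - risk_eps I) / risk_eps I * a).
have b_b0 : b <= b0 by rewrite ge_min lexx.
have b_le : risk_eps I * b <= (1 - risk_eps I) * a.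
  by rewrite -ler_pdivlMl// mulrA [(risk_eps I)^-1 * _]mulrC ge_min lexx orbT.
have b_ge0 : 0 <= b.
  by rewrite le_min b0_ge0 /= mulr_ge0 ?divr_ge0// ?subr_ge0; exact: ltW.
have [b_loss total] : b0 - b <= eta / risk_eps I /\ cond_eps I <= a + b.
  rewrite ler_pdivlMr// /b.
  have [h|h] := leP b0 ((1 - risk_eps I) / risk_eps I * a).
    by rewrite subrr mul0r; split=> //; lra.
  set c := _ / _ * _ in h *.
  have ec : risk_eps I * c = (1 - risk_eps I) * a by rewrite /c; field; lra.
  have h1 : 0 <= (1 - risk_eps I) * (a - a0).
    by rewrite mulr_ge0 // subr_ge0 // ltW.
  split; first by move: defect ec h1; lra.
  by rewrite -(ler_pM2l risk0) mulrDr ec; lra.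
have [rho [rho0 rho1 erho]] : exists rho, [/\ 0 <= rho, rho <= 1 & rho * b0 = b].
  have [b00|b0_neq0] := eqVneq b0 0.
    exists 1; split=> //; rewrite mul1r; apply/eqP; rewrite eq_le b_b0 andbT.
    by rewrite b00.
  have b0_gt0 : 0 < b0 by rewrite lt_neqAle eq_sym b0_neq0.
  exists (b / b0); split; [exact: divr_ge0| |by rewrite divfK].
  by rewrite ler_pdivrMr// mul1r.
pose w' : 'rV[R]_N := \row_i (if i \in S then up i else rho * w 0 i).
pose f := risk_eps I * (a + b) / a.
have f0 : 0 <= f by rewrite divr_ge0 ?mulr_ge0// ?addr_ge0 // ltW.
have f1 : f <= 1 by rewrite ler_pdivrMr//; nra.
pose r' : 'rV[R]_N := \row_i (if i \in S then f * up i else 0).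
have sum_w' : \sum_i w' 0 i = a + b.
  rewrite splitS; congr (_ + _).
    by apply: eq_bigr => i iS; rewrite mxE iS.
  rewrite -erho mulr_sumr; apply: eq_bigr => i /negbTE iS; by rewrite mxE iS.
exists w', r'; split => [|i /negbTE iS|i]; last 2 first.
- by rewrite mxE iS.
- rewrite mxE; case: ifPn => iS.
    rewrite ger0_norm ?subr_ge0//; apply: le_trans (_ : eta <= _).
      by rewrite lerBlDl ge_min lexx.
    by rewrite ler_pdivlMr// ler_piMr// ltW.
  have w_b0 : w 0 i <= b0.
    by rewrite /b0 (bigD1 i)//= lerDl sumr_ge0.
  rewrite ler0_norm; last by have := w_ge0 i; nra.
  by apply: le_trans b_loss; have := w_ge0 i; nra.
split => /=; rewrite ?sum_w'//.
- move=> i; rewrite !mxE; case: ifP => iS; last by rewrite lexx mulr_ge0.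
  have up0 := le_trans (w_ge0 i) (w_up i).
  by rewrite mulr_ge0//= ler_piMl.
- move=> i; rewrite mxE; case: ifP => iS; first by rewrite ge_min lexx orbT.
  by apply: le_trans (hw i); rewrite ler_piMl.
- rewrite splitS [X in _ + X]big1 ?addr0; last first.
    by move=> i /negbTE iS; rewrite mxE iS.
  rewrite (eq_bigr (fun i => f * up i)); last by move=> i iS; rewrite mxE iS.
  by rewrite -mulr_sumr -/a divfK// gt_eqF.
Qed.

Definition off_penalty S (M : R) : 'rV[R]_N := \row_i (if i \in S then 0 else M).

(** With room in [S], the penalty only has to outweigh the Lipschitz constant
    of the contextual cost times the error bound of [Cset_repair].  Without
    room, the risky mass off [S] is at least the missing capacity [gap], and
    the penalty has to lift the lower bound [lo] of the contextual cost to
    [theta I]. *)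
Lemma exact_penalty S : ((theta I)%:E <= Tval I S)%E ->
  exists2 M, 0 <= M & ((theta I)%:E <= vartheta I (off_penalty S M))%E.
Proof.
move=> hT.
have /andP[cond0 _] := cond_eps_bounds hI.
have /andP[risk0 risk1] := risk_eps_bounds hI.
pose B := \sum_i `|kbar I i|.
have B0 : 0 <= B by apply: sumr_ge0.
have Lip w w' e : (forall i, `|w' 0 i - w 0 i| <= e) ->
    kcost I w' - kcost I w <= B * e.
  move=> h; rewrite /kcost opprD addrACA subrr add0r -sumrB mulr_suml.
  apply: ler_sum => i _; rewrite -mulrBr; apply: le_trans (ler_norm _) _.
  by rewrite normrM ler_wpM2l.
have pen M r : dot (off_penalty S M) r = M * \sum_(i | i \notin S) r 0 i.
  rewrite /dot (bigID (mem S)) /= big1 ?add0r => [|i iS].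
    by rewrite mulr_sumr; apply: eq_bigr => i /negbTE iS; rewrite mxE iS.
  by rewrite mxE iS mul0r.
have [cap|nocap] := leP (risk_eps I * cond_eps I) (#|S|%:R * N%:R^-1).
  exists (B / risk_eps I); first by rewrite divr_ge0// ltW.
  apply/ereal_infP => _ [[w r] /= hC <-]; rewrite pen.
  have [w' [r' [hC' r0 /Lip lip]]] := Cset_repair cap hC.
  have := le_trans hT (Tval_le hC' r0); rewrite !lee_fin.
  by move: lip; rewrite -!mulrA [_^-1 * _]mulrC; lra.
pose gap := risk_eps I * cond_eps I - #|S|%:R * N%:R^-1.
have gap0 : 0 < gap by rewrite subr_gt0.
pose lo := K0 I - B * N%:R^-1.
exists (`|theta I - lo| / gap); first by rewrite divr_ge0// ltW.
apply/ereal_infP => _ [[w r] /= [/= hr hw hcond hrisk] <-]; rewrite pen lee_fin.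
have eta_ge : gap <= \sum_(i | i \notin S) r 0 i.
  have : \sum_(i in S) r 0 i <= #|S|%:R * N%:R^-1.
    rewrite mulr_natl -sumr_const; apply: ler_sum => i _.
    by have /andP[_ /le_trans->] := hr i.
  move: hrisk; rewrite (bigID (mem S)) /= /gap.
  have : 0 <= risk_eps I * (\sum_i w 0 i - cond_eps I).
    by rewrite mulr_ge0 ?subr_ge0// ltW.
  by lra.
have lo_le : lo <= kcost I w.
  have h i : `|(0 : 'rV[R]_N) 0 i - w 0 i| <= N%:R^-1.
    rewrite mxE sub0r normrN ger0_norm//.
    by have /andP[] := hr i; exact: le_trans.
  have := Lip w 0 _ h; rewrite {1}/kcost big1 ?addr0 => [|i _].
    by rewrite /lo; lra.
  by rewrite mxE mulr0.
have : `|theta I - lo| <= `|theta I - lo| / gap * \sum_(i | i \notin S) r 0 i.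
  by rewrite mulrAC ler_pdivlMr// ler_wpM2l.
by have := ler_norm (theta I - lo); lra.
Qed.

Lemma Tval_projection S : ((theta I)%:E <= Tval I S)%E ->
  projection_feasible I [ffun i => i \in S].
Proof.
move=> /exact_penalty[M M0 hM]; exists (off_penalty S M); split=> // i.
  by rewrite mxE; case: ifP.
by rewrite ffunE mxE => ->.
Qed.

End Proof.

Theorem theorem9 (R : realType) (X : pMetricType R) (n q P N : nat)
    (I : instance X n q P N) (hI : standing I)
    (tie : rel 'I_N) (tie_total : total tie) (tie_trans : transitive tie)
    (tie_anti : antisymmetric tie) (A : {set 'I_N}) :
  [/\ forall (k : nat) (S : {set 'I_N}),
        (k <= #|A|)%N -> S \subset A -> #|S| = k ->
        (Tval I S <= Tval I (topk I tie A k))%E,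
      forall (z : 'rV[R]_q) (delta : 'rV[R]_N) (fz : {ffun 'I_N -> bool})
             (t lambda : R) (s v : 'rV[R]_N),
        mip_feasible I z delta fz t lambda s v ->
        (\sum_(i in A) fz i <= Rbound I tie A)%N
    & (exists2 fz : {ffun 'I_N -> bool},
         projection_feasible I fz & (\sum_(i in A) fz i)%N = Rbound I tie A) /\
      (forall fz : {ffun 'I_N -> bool},
         projection_feasible I fz -> (\sum_(i in A) fz i <= Rbound I tie A)%N)].
Proof.
split.
- by move=> k S; apply: Tval_le_topk.
- move=> z delta fz t lambda s v /mip_projection h.
  exact: projection_le_Rbound.
- split; last by move=> fz; apply: projection_le_Rbound.
  have [hT hk] := Tval_topk_Rbound hI tie A.
  exists [ffun i => i \in topk I tie A (Rbound I tie A)].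
    exact: Tval_projection.
  rewrite -[RHS](card_topk I tie hk) -sum1_card.
  rewrite (eq_bigr (fun i => i \in topk I tie A (Rbound I tie A) : nat)); last first.
    by move=> i _; rewrite ffunE.
  rewrite -big_mkcondr /=; apply: eq_bigl => i.
  apply: andb_idl; exact: (fintype.subsetP (topk_sub I tie A _)).
Qed.
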